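(* Let $n\in\mathbb N$ and $P=[\tfrac1{2n},\,2+n-\tfrac1{2n}]^n\subseteq\mathbb R^n$. Then $P_I:=\operatorname{conv}(P\cap\mathbb Z^n)=[1,n+1]^n$, and, with respect to $P$ and branch-and-cut trees based on any subfamily $\mathcal D$ of the split disjunctions in $\mathbb R^n$ that includes all variable disjunctions, all facets of $P_I$ are defined by Chvátal-Gomory cuts (obtained from the bound inequalities defining $P$) with validity complexity $O(1)$ (bounded by an absolute constant independent of $n$), while the validity complexity of the halfspace $\{x\in\mathbb R^n:\sum_{i=1}^n x_i\ge n\}$ is $2n+1$.
   Context: A split disjunction is the pair $\{x\in\mathbb R^n:\langle\alpha,x\rangle\le\beta\}$, $\{x\in\mathbb R^n:\langle\alpha,x\rangle\ge\beta+1\}$ with $\alpha\in\mathbb Z^n\setminus\{0\}$, $\beta\in\mathbb Z$; its split set is $\{x:\beta<\langle\alpha,x\rangle<\beta+1\}$. A variable disjunction is a split disjunction with $\alpha$ a standard unit vector, i.e. $\{x_i\le\beta\}$, $\{x_i\ge\beta+1\}$. The Chvátal-Gomory cut generated from a rational closed halfspace $G\subseteq\mathbb R^n$ containing $P$ is the halfspace $\operatorname{conv}(G\cap\mathbb Z^n)$ (the inequality with coprime integer coefficients defining $G$, with its right-hand side rounded). A branch-and-cut tree based on a family $\mathcal D$ of split disjunctions is a finite rooted tree in which every node has a corresponding convex set in $\mathbb R^n$, the root having the set $P$. An internal node with set $K$ is of one of two types: (a) branching: it is labelled by a split disjunction $D_1,D_2$ in $\mathcal D$ and has two children, with sets $K\cap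 D_1$ and $K\cap D_2$; (b) cutting: it is labelled by a halfspace $H$ (a convex set $H\subseteq\mathbb R^n$ with convex complement $H^c$) derived from a split disjunction $D_1,D_2$ in $\mathcal D$, meaning $K\cap D_1\subseteq H$ and $K\cap D_2\subseteq H$ (equivalently, $K\cap H^c$ is contained in the split set); it has two children: the right child has set $K\cap H$, and the left child is a leaf with set $K\cap H^c$, called a cutting plane certifier, which carries a certificate that $K\cap H^c\cap\mathbb Z^n=\emptyset$, of positive integer size. The size of the tree is its number of nodes plus the sum of the sizes of the certificates at the cutting plane certifiers. The validity complexity of a halfspace $H\supseteq P\cap\mathbb Z^n$ is the smallest size of a tree such that, for every leaf that is not a cutting plane certifier, the corresponding set is contained in $H$. The validity complexity of a facet of $P_I$ is the minimum validity complexity of the halfspaces defining it. *)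

(* Defs.v *)
From HB Require Import structures.
From mathcomp Require Import all_boot all_order all_algebra.
From mathcomp Require Import mathcomp_extra boolp classical_sets reals convex.

Set Implicit Arguments.
Unset Strict Implicit.
Unset Printing Implicit Defensive.

Import Order.TTheory GRing.Theory Num.Theory.
Local Open Scope classical_set_scope.
Local Open Scope ring_scope.

Definition is_minimum (A : set nat) (m : nat) : Prop :=
  A m /\ forall k, A k -> (m <= k)%N.

Section Geometry.
Variables (R : realType) (n : nat).
Implicit Types (x u : 'rV[R]_n) (K P H F G : set 'rV[R]_n).

Definition dot u x : R := \sum_(i < n) u 0 i * x 0 i.

Definition integer_points : set 'rV[R]_n :=
  [set x | exists z : 'rV[int]_n, x = map_mx intr z].

Definition convex_hull (A : set 'rV[R]_n) : set 'rV[R]_n :=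
  smallest (@convex_set R 'rV[R]_n) A.

Definition integer_hull P : set 'rV[R]_n := convex_hull (P `&` integer_points).

(* Halfspaces need not be open or closed. *)
Definition halfspace H : Prop :=
  @convex_set R 'rV[R]_n H /\ @convex_set R 'rV[R]_n (~` H).

Definition closed_halfspace u (b : R) : set 'rV[R]_n := [set x | dot u x <= b].

Definition rational_halfspace G : Prop :=
  exists (c : 'rV[rat]_n) (d : rat),
    c != 0 /\ G = closed_halfspace (map_mx ratr c) (ratr d).

(* H is the Chvatal-Gomory cut for P generated from G. *)
Definition CG_cut P G H : Prop :=
  [/\ rational_halfspace G, P `<=` G & H = convex_hull (G `&` integer_points)].

Definition face_of P F : Prop :=
  exists u (b : R),
    P `<=` closed_halfspace u b /\ F = P `&` [set x | dot u x = b].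

Definition proper_face P F : Prop := [/\ face_of P F, F !=set0 & F <> P].

Definition facet P F : Prop :=
  proper_face P F /\ forall F', proper_face P F' -> F `<=` F' -> F' = F.

Definition defines_face P H F : Prop :=
  exists u (b : R),
    [/\ u != 0, H = closed_halfspace u b, P `<=` H
      & F = P `&` [set x | dot u x = b]].

Definition cube (a b : R) : set 'rV[R]_n :=
  [set x | forall i, a <= x 0 i <= b].

End Geometry.

Record split_disjunction (n : nat) := SplitDisjunction {
  split_normal : 'rV[int]_n;
  split_level : int;
  split_normal_neq0 : split_normal != 0 }.

Definition variable_disjunctions (n : nat) : set (split_disjunction n) :=
  [set s | exists i : 'I_n, split_normal s = delta_mx 0 i].

(* Certificates are left abstract: any sound notion of certificate of
   integer infeasibility, with any positive size function, is allowed. *)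
Record certificate_system (R : realType) (n : nat) := CertificateSystem {
  cert :> Type;
  cert_size : cert -> nat;
  cert_size_gt0 : forall c, (0 < cert_size c)%N;
  certifies : cert -> set 'rV[R]_n -> Prop;
  certifies_sound :
    forall c K, certifies c K -> K `&` @integer_points R n = set0 }.

Section BranchAndCut.
Variables (R : realType) (n : nat) (C : certificate_system R n).
Implicit Types (K P H F : set 'rV[R]_n) (s : split_disjunction n).
Implicit Types (D : set (split_disjunction n)).

Definition split_lo s : set 'rV[R]_n :=
  [set x | dot (map_mx intr (split_normal s)) x <= (split_level s)%:~R].

Definition split_hi s : set 'rV[R]_n :=
  [set x | (split_level s)%:~R + 1 <= dot (map_mx intr (split_normal s)) x].

Definition derived_from K s H : Prop :=
  K `&` split_lo s `<=` H /\ K `&` split_hi s `<=` H.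

(* The left child of a cutting node is always a certifier leaf, so Cut keeps
   only its certificate together with the subtree at the right child. *)
Inductive bc_tree : Type :=
| Leaf
| Branch of split_disjunction n & bc_tree & bc_tree
| Cut of set 'rV[R]_n & cert C & bc_tree.

Fixpoint num_nodes (t : bc_tree) : nat :=
  match t with
  | Leaf => 1
  | Branch _ t1 t2 => (1 + num_nodes t1 + num_nodes t2)%N
  | Cut _ _ t' => (1 + 1 + num_nodes t')%N
  end.

Fixpoint certificates_size (t : bc_tree) : nat :=
  match t with
  | Leaf => 0
  | Branch _ t1 t2 => (certificates_size t1 + certificates_size t2)%N
  | Cut _ c t' => (cert_size c + certificates_size t')%N
  end.

Definition tree_size (t : bc_tree) : nat :=
  (num_nodes t + certificates_size t)%N.

(* t is a branch-and-cut tree based on D when its root has the set K. *)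
Fixpoint based_on D K (t : bc_tree) : Prop :=
  match t with
  | Leaf => True
  | Branch s t1 t2 =>
      [/\ D s, based_on D (K `&` split_lo s) t1
        & based_on D (K `&` split_hi s) t2]
  | Cut H c t' =>
      [/\ halfspace H, exists2 s, D s & derived_from K s H,
          certifies c (K `&` ~` H) & based_on D (K `&` H) t']
  end.

(* Every leaf other than the certifiers has its set contained in H. *)
Fixpoint leaves_within H K (t : bc_tree) : Prop :=
  match t with
  | Leaf => K `<=` H
  | Branch s t1 t2 =>
      leaves_within H (K `&` split_lo s) t1 /\
      leaves_within H (K `&` split_hi s) t2
  | Cut H' _ t' => leaves_within H (K `&` H') t'
  end.

Definition validity_complexity D P H (m : nat) : Prop :=
  [/\ halfspace H, P `&` @integer_points R n `<=` H &
      is_minimum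
        [set tree_size t | t in [set t | based_on D P t /\ leaves_within H P t]]
        m].

Definition facet_validity_complexity D P F (m : nat) : Prop :=
  is_minimum
    [set k | exists2 H, defines_face (integer_hull P) H F &
                        validity_complexity D P H k] m.

End BranchAndCut.

Section Example.
Variables (R : realType) (n : nat).

Definition box_lo : R := 1 / (2 * n%:R).
Definition box_hi : R := 2 + n%:R - 1 / (2 * n%:R).
Definition box : set 'rV[R]_n := cube box_lo box_hi.

Definition bound_halfspace (G : set 'rV[R]_n) : Prop :=
  exists i : 'I_n, G = [set x | box_lo <= x 0 i] \/ G = [set x | x 0 i <= box_hi].

End Example.

(* Main.v *)
(* Lower bound: a point of the box at which the normals of all the disjunctions of
   a tree take integral values avoids every split set, hence survives to a leaf
   that is not a certifier.  A tree of size below 2n + 1 uses fewer than n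
   disjunctions, so the normals share a kernel direction, and moving an integral
   point slightly along it enters the box outside the target halfspace. *)
Require Import Defs.
From mathcomp Require Import all_boot all_order all_algebra.
From mathcomp Require Import boolp classical_sets reals.
From mathcomp Require Import convex interval_inference ring lra zify.

Import Order.TTheory GRing.Theory Num.Theory.
Local Open Scope classical_set_scope.
Local Open Scope ring_scope.

(** One witness is enough to bound a complexity from above: well-ordering supplies the minimum, with
    membership in [A] decided classically. *)
Lemma minimum_below (A : set nat) (k : nat) :
  A k -> exists2 m, is_minimum A m & (m <= k)%N.
Proof.
move=> Ak; have exA : exists k, `[< A k >] by exists k; apply/asboolP.
have [m /asboolP Am minm] := ex_minnP exA.
exists m; last by apply/minm/asboolP.
by split=> // j Aj; apply/minm/asboolP.
Qed.

(** * Convexity, halfspaces and the facets of a cube *)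

Section Geometry.
Variables (R : realType) (n : nat).
Implicit Types (x y u : 'rV[R]_n) (A F : set 'rV[R]_n) (i j : 'I_n).

Lemma convex_setE A :
  @convex_set R 'rV[R]_n A <->
  forall x y (t : R), 0 <= t <= 1 -> A x -> A y -> A (t *: x + (1 - t) *: y).
Proof.
split=> [cA x y t /andP[t0 t1] Ax Ay|cA x y t /set_mem Ax /set_mem Ay].
  by have /set_mem := cA x y (Itv01 t0 t1) (mem_set Ax) (mem_set Ay).
apply/mem_set/cA => //.
by rewrite ge0 le1.
Qed.

Lemma dotDr u x y : dot u (x + y) = dot u x + dot u y.
Proof. by rewrite /dot -big_split; apply: eq_bigr => i _; rewrite mxE mulrDr. Qed.

Lemma dotZr u (t : R) x : dot u (t *: x) = t * dot u x.
Proof. by rewrite /dot mulr_sumr; apply: eq_bigr => i _; rewrite mxE mulrCA. Qed.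

Lemma dotC u x : dot u x = dot x u.
Proof. by apply: eq_bigr => i _; rewrite mulrC. Qed.

Lemma dotZl u (t : R) x : dot (t *: u) x = t * dot u x.
Proof. by rewrite dotC dotZr dotC. Qed.

Lemma dot_delta i x : dot (delta_mx 0 i) x = x 0 i.
Proof.
rewrite /dot (bigD1 i)//= big1 => [|j /negbTE ji]; rewrite mxE ?eqxx ?ji ?andbF.
  by rewrite mul1r addr0.
by rewrite mul0r.
Qed.

Lemma dot_map_intr (a z : 'rV[int]_n) :
  dot (map_mx intr a) (map_mx intr z) \is a @Num.int R.
Proof. by rewrite rpred_sum// => i _; rewrite !mxE rpredM ?intr_int. Qed.

Lemma halfspace_closed u (b : R) : halfspace (closed_halfspace u b).
Proof.
split; apply/convex_setE => x y t /andP[t0 t1]; rewrite /closed_halfspace /=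
  dotDr !dotZr.
  move=> xb yb.
  have : 0 <= t * (b - dot u x) by rewrite mulr_ge0 ?subr_ge0.
  have : 0 <= (1 - t) * (b - dot u y) by rewrite mulr_ge0 ?subr_ge0.
  lra.
move=> /negP; rewrite -ltNge => bx /negP; rewrite -ltNge => yb.
apply/negP; rewrite -ltNge.
(* A convex combination is at least the smaller of the two values; that minimum exceeds [b]
   strictly, so strictness survives [t = 0] and [t = 1]. *)
have m0 : b < Order.min (dot u x) (dot u y) by rewrite lt_min bx yb.
have : 0 <= t * (dot u x - Order.min (dot u x) (dot u y)).
  by rewrite mulr_ge0// subr_ge0 ge_min lexx.
have : 0 <= (1 - t) * (dot u y - Order.min (dot u x) (dot u y)).
  by rewrite mulr_ge0 ?subr_ge0// ge_min lexx orbT.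
lra.
Qed.

Lemma le_coord_closed i (b : R) :
  [set x : 'rV[R]_n | x 0 i <= b] = closed_halfspace (delta_mx 0 i) b.
Proof. by apply/seteqP; split=> x; rewrite /closed_halfspace /= dot_delta. Qed.

Lemma ge_coord_closed i (b : R) :
  [set x : 'rV[R]_n | b <= x 0 i] = closed_halfspace (- delta_mx 0 i) (- b).
Proof.
by apply/seteqP; split=> x;
  rewrite /closed_halfspace /= -scaleN1r dotZl dot_delta mulN1r lerN2.
Qed.

Lemma delta_row_neq0 (K : nzRingType) i : delta_mx 0 i != 0 :> 'rV[K]_n.
Proof. by apply/eqP => /rowP/(_ i)/eqP; rewrite !mxE !eqxx oner_eq0. Qed.

(* Moving one non-integral coordinate to its two integral neighbours writes the
   point as a convex combination of points with fewer such coordinates. *)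
Lemma convex_integer_fill (S : 'I_n -> set R) A :
    @convex_set R 'rV[R]_n A ->
    (forall i r, S i r -> r \isn't a Num.int ->
      S i (Num.floor r)%:~R /\ S i (Num.floor r + 1)%:~R) ->
    (forall x, integer_points x -> (forall i, S i (x 0 i)) -> A x) ->
  forall x, (forall i, S i (x 0 i)) -> A x.
Proof.
move=> /convex_setE cA Sfloor intA x.
have [k] := ubnP #|[pred i | x 0 i \isn't a Num.int]|.
elim: k x => // k IHk x; rewrite ltnS => ltk Sx.
have [i xi|xint] := pickP (fun i => x 0 i \isn't a Num.int); last first.
  apply: intA => //; exists (\row_j Num.floor (x 0 j)).
  apply/rowP => j; rewrite !mxE; apply/esym/eqP.
  by rewrite -intrEfloor; apply: negbFE (xint j).
pose m := Num.floor (x 0 i).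
pose y (c : int) : 'rV[R]_n := \row_j if j == i then c%:~R else x 0 j.
have [Sm Sm1] := Sfloor _ _ (Sx i) xi.
have Ay c : S i c%:~R -> A (y c).
  move=> Sc; apply: IHk => [|j]; last by rewrite mxE; case: eqP => [->|].
  apply: leq_trans ltk; apply: proper_card; apply/properP; split.
    apply/fintype.subsetP => j; rewrite !inE mxE.
    by case: eqP => // ->; rewrite intr_int.
  by exists i; rewrite !inE ?xi// mxE eqxx intr_int.
have /andP[mx xm] := floor_itv (x 0 i); rewrite -/m rmorphD /= in mx xm.
have -> : x = (m%:~R + 1 - x 0 i) *: y m + (1 - (m%:~R + 1 - x 0 i)) *: y (m + 1).
  by apply/rowP => j; rewrite !mxE rmorphD /=; case: eqP => [->|_]; ring.
apply: cA; [lra|exact: Ay..].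
Qed.

(** If [u 0 i] is nonzero, every point of the face has coordinate [i] at the end of [[a, b]]
    favoured by the sign of [u 0 i]. The face thus lies in a coordinate face, and maximality makes
    them equal. *)
Lemma facet_cube (a b : R) F : a < b -> facet (cube a b) F ->
  exists i (s : bool),
    F = cube a b `&` [set x | x 0 i = if s then b else a].
Proof.
move=> ab [[[u [c [Puc ->]]] [x0 [Px0 /= ux0]] neqP] maxF].
have [i ui|u0] := pickP (fun i => u 0 i != 0); last first.
  (* If [u = 0], the equation [dot u x = c] holds everywhere and the face is the whole cube. *)
  case: neqP; apply/seteqP; split=> [x []//|x Px]; split=> //=.
  have dot0 y : dot u y = 0.
    by rewrite /dot big1// => i _; rewrite (eqP (negbFE (u0 i))) mul0r.
  by rewrite dot0 -ux0 dot0.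
pose s := 0 < u 0 i; pose e : R := if s then b else a.
have abe : a <= e <= b by rewrite /e; case: ifP => _; rewrite ?lexx ?ltW.
exists i, s; rewrite -[LHS](maxF (cube a b `&` [set x | x 0 i = e]))//.
- split.
  + exists ((if s then 1 else -1) *: delta_mx 0 i), (if s then b else - a).
    rewrite /e; split; last first.
      by congr (_ `&` _); apply/seteqP; split=> x /=; rewrite dotZl dot_delta;
        case: (s); lra.
    move=> x /(_ i) xi; rewrite /closed_halfspace /= dotZl dot_delta.
    by case: (s); lra.
  + by exists (const_mx e); split=> [j|] /=; rewrite mxE.
  (* The constant vector at the opposite end lies in the cube but not in the coordinate face. *)
  + move=> /seteqP[_ /(_ (const_mx (if s then a else b)))] [].
      by move=> j; rewrite mxE; case: (s); rewrite ?lexx ?ltW.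
    by move=> _ /=; rewrite mxE /e; case: (s); lra.
move=> x [Px /= ux]; split=> //=.
(* Pushing coordinate [i] to [e] stays in the cube, so validity gives [(e - x 0 i) * u 0 i <= 0];
   the sign of [u 0 i] then forces [x 0 i = e]. *)
have /Puc : cube a b (x + (e - x 0 i) *: delta_mx 0 i).
  move=> j; rewrite !mxE; have [->|_] := eqVneq j i; last first.
    by rewrite andbF mulr0 addr0.
  by rewrite eqxx mulr1 addrC subrK.
rewrite /closed_halfspace /= dotDr dotZr ux dotC dotC (dotC u) dot_delta.
have := Px i; rewrite /e /s; case: ltgtP ui => // u0 _ xi h; nra.
Qed.

End Geometry.

(** * Bounds on tree sizes *)

Section BranchAndCut.
Variables (R : realType) (n : nat) (C : certificate_system R n).
Implicit Types (K P H : set 'rV[R]_n) (x : 'rV[R]_n).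
Implicit Types (D : set (split_disjunction n)) (t : bc_tree C).

Lemma validity_complexity_le D P H t :
    halfspace H -> P `&` @integer_points R n `<=` H ->
    based_on D P t -> leaves_within H P t ->
  exists2 m, validity_complexity C D P H m & (m <= tree_size t)%N.
Proof.
move=> hH PH tP tH.
have [|m minm le_m] := @minimum_below
  [set tree_size t | t in [set t : bc_tree C | based_on D P t /\ leaves_within H P t]]
  (tree_size t); first by exists t.
by exists m.
Qed.

Lemma defines_face_valid P F H D m :
  defines_face (integer_hull P) H F -> validity_complexity C D P H m ->
  exists2 k, facet_validity_complexity C D P F k & (k <= m)%N.
Proof. by move=> HF vH; apply: minimum_below; exists H. Qed.

(* A point at which the normals of all the disjunctions used are integral lies
   in none of the split sets, so it reaches a leaf that is not a certifier. *)
Lemma tree_normals D K H t : based_on D K t -> leaves_within H K t ->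
  exists2 s : seq 'rV[int]_n, (2 * size s + 1 <= tree_size t)%N &
    forall x, K x -> {in s, forall a, dot (map_mx intr a) x \is a Num.int} -> H x.
Proof.
have split_int (d : split_disjunction n) x :
    dot (map_mx intr (split_normal d)) x \is a Num.int ->
    split_lo d x \/ split_hi d x.
  rewrite /split_lo /split_hi /= => /intrP[m ->].
  have [mb|bm] := lerP m (split_level d); first by left; rewrite ler_int.
  by right; rewrite -[1]/(1%:~R) -rmorphD ler_int lezD1.
elim: t K => [|d t1 IH1 t2 IH2|H' c t' IH] K /=.
- by move=> _ KH; exists [::] => // x Kx _; apply: KH.
- move=> [_ /IH1 {}IH1 /IH2 {}IH2] [/IH1[s1 le1 h1] /IH2[s2 le2 h2]].
  (* The count is exact: [1 + (2 a + 1) + (2 b + 1) = 2 (a + b + 1) + 1]. *)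
  exists (split_normal d :: s1 ++ s2).
    by move: le1 le2; rewrite /= size_cat /tree_size /=; lia.
  move=> x Kx xs.
  have xs1 : {in s1, forall a, dot (map_mx intr a) x \is a Num.int}.
    by move=> a sa; apply: xs; rewrite inE mem_cat sa orbT.
  have xs2 : {in s2, forall a, dot (map_mx intr a) x \is a Num.int}.
    by move=> a sa; apply: xs; rewrite inE mem_cat sa !orbT.
  by case: (split_int d x (xs _ (mem_head _ _))) => dx; [apply: h1|apply: h2].
- move=> [_ [d _ [Hlo Hhi]] _ /IH {}IH] /IH[s le_s h].
  (* The cutting node and its certifier leaf pay for the new normal. *)
  exists (split_normal d :: s).
    by move: le_s (cert_size_gt0 c); rewrite /tree_size /=; lia.
  move=> x Kx xs; apply: h; last first.
    by move=> a sa; apply: xs; rewrite inE sa orbT.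
  (* The cut keeps [x]: it contains both parts of [K] outside the split set. *)
  split=> //.
  by case: (split_int d x (xs _ (mem_head _ _))) => dx; [apply: Hlo|apply: Hhi].
Qed.

Definition variable_disjunction (i : 'I_n) (b : int) : split_disjunction n :=
  SplitDisjunction b (delta_row_neq0 n int i).

Lemma split_lo_variable i b :
  @split_lo R n (variable_disjunction i b) = [set x | x 0 i <= b%:~R].
Proof.
by apply/seteqP; split=> x; rewrite /split_lo /= map_delta_mx dot_delta.
Qed.

Lemma split_hi_variable i b :
  @split_hi R n (variable_disjunction i b) = [set x | b%:~R + 1 <= x 0 i].
Proof.
by apply/seteqP; split=> x; rewrite /split_hi /= map_delta_mx dot_delta.
Qed.

(** A caterpillar: on sets with positive coordinates the child [x 0 i <= 0] is empty, hence a leaf,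
    and the tree goes on in the child [1 <= x 0 i]. *)
Definition positivity_tree (s : seq 'I_n) : bc_tree C :=
  foldr (fun i => Branch (variable_disjunction i 0) (Leaf C)) (Leaf C) s.

Lemma positivity_tree_size s : tree_size (positivity_tree s) = (2 * size s + 1)%N.
Proof. by elim: s => //= i s; rewrite /tree_size /=; lia. Qed.

Lemma positivity_tree_based D K s :
  @variable_disjunctions n `<=` D -> based_on D K (positivity_tree s).
Proof.
by move=> vD; elim: s K => //= i s IHs K; split=> //; apply: vD; exists i.
Qed.

Lemma positivity_tree_leaves H K s :
    (forall x i, K x -> 0 < x 0 i) ->
    (forall x, K x -> {in s, forall i, 1 <= x 0 i} -> H x) ->
  leaves_within H K (positivity_tree s).
Proof.
elim: s K => [|i s IHs] K K0 KH /=; first by move=> x Kx; apply: KH.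
rewrite split_lo_variable split_hi_variable; split.
  by move=> x [/(K0 _ i) xi /=]; rewrite leNgt xi.
apply: IHs => [x j [/K0]//|x [Kx /=]]; rewrite add0r => xi xs.
by apply: KH => // j; rewrite inE => /predU1P[->|/xs].
Qed.

End BranchAndCut.

(* A common kernel vector, scaled so that its largest entry is e at index i, is
   added to or subtracted from the all-ones vector if its entries do not sum to 0,
   and added to the all-ones vector minus the i-th unit vector if they do. *)
Lemma few_normals_integral (R : realType) (n : nat) (e : R) (s : seq 'rV[int]_n) :
    0 < e <= 1 / 2 -> (size s < n)%N ->
  exists2 x : 'rV[R]_n, cube e (1 + e) x /\ \sum_(i < n) x 0 i < n%:R &
    {in s, forall a, dot (map_mx intr a) x \is a Num.int}.
Proof.
move=> /andP[e0 e2] lt_s.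
(* The normals are the columns, so a left kernel vector is orthogonal to all of them; it exists
   because there are fewer columns than rows. *)
pose M : 'M[R]_(n, size s) := \matrix_(i, j) (nth 0 s j 0 i)%:~R.
pose d := nz_row (kermx M).
have d0 : d != 0.
  rewrite nz_row_eq0 kermx_eq0 -row_leq_rank -ltnNge.
  exact: leq_ltn_trans (rank_leq_col _) lt_s.
have sd : {in s, forall a, dot (map_mx intr a) d = 0}.
  move=> a /(nthP 0)[j lt_j <-].
  have /sub_kermxP/rowP/(_ (Ordinal lt_j)) := nz_row_sub (kermx M).
  rewrite !mxE => <-; apply: eq_bigr => i _.
  by rewrite !mxE mulrC.
have [i [di maxi]] : exists i, d 0 i != 0 /\ forall k, `|d 0 k| <= `|d 0 i|.
  have /rV0Pn[i0 di0] := d0.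
  have [i _ maxi] := @Order.TotalTheory.arg_maxP _ _ _ i0 xpredT (fun k => `|d 0 k|) isT.
  exists i; split=> [|k]; last exact: maxi.
  by rewrite -normr_gt0; apply: lt_le_trans (maxi i0 isT); rewrite normr_gt0.
pose w := (e / d 0 i) *: d.
have wi : w 0 i = e by rewrite mxE divfK.
have we k : - e <= w 0 k <= e.
  rewrite -ler_norml mxE normrM normf_div (gtr0_norm e0) -mulrA ger_pMr//.
  by rewrite mulrC ler_pdivrMr ?normr_gt0// mul1r.
have sw a : a \in s -> dot (map_mx intr a) w = 0.
  by move=> /sd; rewrite dotZr => ->; rewrite mulr0.
(* The normals take integral values at [z] and vanish on [w], so only the bounds and the sum remain
   to be checked. *)
have main (z : 'rV[int]_n) (c : R) :
    (forall k, e <= (z 0 k)%:~R + c * w 0 k <= 1 + e) ->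
    \sum_k (z 0 k)%:~R + c * \sum_k w 0 k < n%:R ->
  exists2 x : 'rV[R]_n, cube e (1 + e) x /\ \sum_(i < n) x 0 i < n%:R &
    {in s, forall a, dot (map_mx intr a) x \is a Num.int}.
  move=> zb zs; exists (map_mx intr z + c *: w).
    split=> [k|]; first by rewrite 3!mxE.
    under eq_bigr do rewrite 3!mxE.
    by rewrite big_split -mulr_sumr.
  by move=> a sa; rewrite dotDr dotZr sw// mulr0 addr0 dot_map_intr.
have sum1 : \sum_(k < n) ((const_mx 1 : 'rV[int]_n) 0 k)%:~R = n%:R :> R.
  under eq_bigr do rewrite mxE.
  by rewrite sumr_const card_ord.
have [w0|w0|w0] := ltgtP (\sum_k w 0 k) 0.
(* The sign is chosen so that the sum decreases; [e <= 1 / 2] gives [e <= 1 - e], the lower bound on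
   each coordinate. *)
- apply: (main (const_mx 1) 1); last by rewrite sum1 mul1r gtrDl.
  by move=> k; rewrite mxE mulr1z; have := we k; lra.
- apply: (main (const_mx 1) (-1)); last by rewrite sum1 mulN1r gtrDl oppr_lt0.
  by move=> k; rewrite mxE mulr1z; have := we k; lra.
(* Coordinate [i] becomes [0 + e], exactly the lower end of the cube, while the sum drops to
   [n - 1]. *)
- apply: (main (const_mx 1 - delta_mx 0 i) 1).
    move=> k; rewrite 4!mxE eqxx /=; have [->|_] := eqVneq k i.
      by rewrite wi subrr mulr0z; lra.
    by rewrite subr0 mulr1z; have := we k; lra.
  rewrite w0 mulr0 addr0 -sum1 (bigD1 i)//= [ltRHS](bigD1 i)//= ltr_leD//.
    by rewrite !mxE !eqxx.
  by apply: ler_sum => k _; rewrite !mxE; case: (_ && _).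
Qed.

(** * Integer hulls of coordinate halfspaces and cubes *)

Section CoordinateHulls.
Variables (R : realType) (n : nat).
Implicit Types (x : 'rV[R]_n) (i : 'I_n) (m : int).

Lemma integer_points_coord {x} i : integer_points x -> exists m, x 0 i = m%:~R.
Proof. by move=> [z ->]; exists (z 0 i); rewrite mxE. Qed.

(** Here [m] is the ceiling of [b]. The rounded halfspace is convex and contains the integer points;
    conversely it is filled by moving coordinates to neighbouring integers. *)
Lemma hull_ge_coord i (b : R) m : m%:~R - 1 < b <= m%:~R ->
  convex_hull ([set x : 'rV[R]_n | b <= x 0 i] `&` @integer_points R n) =
  [set x : 'rV[R]_n | m%:~R <= x 0 i].
Proof.
move=> /andP[mb bm]; apply/seteqP; split.
  apply: smallest_sub.
    rewrite ge_coord_closed.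
    by have [] := halfspace_closed R n (- delta_mx 0 i) (- m%:~R).
  move=> x [/= bx xZ]; have [k xk] := integer_points_coord i xZ.
  move: bx; rewrite xk => bk.
  have : (m - 1)%:~R < k%:~R :> R by rewrite rmorphB; apply: lt_le_trans bk.
  by rewrite ltr_int ler_int; lia.
move=> x /= mx A [cA GA].
(* The implication constrains coordinate [i] only and leaves the others free. *)
apply: (convex_integer_fill R n (fun j r => j = i -> m%:~R <= r)) => //.
- move=> j r Sr _.
  have mf : j = i -> m <= Num.floor r by rewrite floor_ge_int.
  by split=> /mf; rewrite ler_int //; lia.
- by move=> y yZ /(_ i erefl) my; apply: GA; split=> //=; apply: le_trans my.
- by move=> j ->.
Qed.

Lemma hull_le_coord i (b : R) m : m%:~R <= b < m%:~R + 1 ->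
  convex_hull ([set x : 'rV[R]_n | x 0 i <= b] `&` @integer_points R n) =
  [set x : 'rV[R]_n | x 0 i <= m%:~R].
Proof.
move=> /andP[mb bm]; apply/seteqP; split.
  apply: smallest_sub.
    by rewrite le_coord_closed; have [] := halfspace_closed R n (delta_mx 0 i) m%:~R.
  move=> x [/= bx xZ]; have [k xk] := integer_points_coord i xZ.
  move: bx; rewrite xk => bk.
  have : k%:~R < (m + 1)%:~R :> R by rewrite rmorphD; apply: le_lt_trans bm.
  by rewrite ltr_int ler_int; lia.
move=> x /= mx A [cA GA].
apply: (convex_integer_fill R n (fun j r => j = i -> r <= m%:~R)) => //.
- move=> j r Sr rint; have /andP[fr _] := floor_itv r; split=> ji.
    exact: le_trans (Sr ji).
  (* Since [r] is not an integer, its floor is strictly below [r <= m], so the next integer is still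
     at most [m]. *)
  rewrite ler_int lezD1 -(ltr_int R) (lt_le_trans _ (Sr ji))//.
  by rewrite lt_neqAle -intrEfloor rint.
- by move=> y yZ /(_ i erefl) my; apply: GA; split=> //=; apply: le_trans mb.
- by move=> j ->.
Qed.

Lemma hull_integer_cube (a b : R) (p q : int) :
    p%:~R - 1 < a <= p%:~R -> q%:~R <= b < q%:~R + 1 ->
  integer_hull (@cube R n a b) = cube p%:~R q%:~R.
Proof.
move=> /andP[pa ap] /andP[qb bq]; apply/seteqP; split.
  apply: smallest_sub.
    apply/convex_setE => x y t /andP[t0 t1] xc yc i; rewrite !mxE.
    have /andP[px xq] := xc i; have /andP[py yq] := yc i.
    have u0 : 0 <= 1 - t by rewrite subr_ge0.
    have tE r : r = t * r + (1 - t) * r by rewrite -mulrDl subrKC mul1r.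
    by rewrite [leLHS]tE [X in _ && (_ <= X)]tE !lerD// ler_wpM2l.
  move=> x [xc xZ] i; have [k xk] := integer_points_coord i xZ.
  have := xc i; rewrite xk => /andP[ak kb].
  have : k%:~R < (q + 1)%:~R :> R by rewrite rmorphD; apply: le_lt_trans bq.
  have : (p - 1)%:~R < k%:~R :> R by rewrite rmorphB; apply: lt_le_trans ak.
  by rewrite !ltr_int !ler_int; lia.
move=> x /= xc A [cA GA].
apply: (convex_integer_fill R n (fun j r => p%:~R <= r <= q%:~R)) => //.
- move=> j r /andP[pr rq] rint; have /andP[fr _] := floor_itv r.
  have pf : p <= Num.floor r by rewrite floor_ge_int.
  have fq : Num.floor r < q.
    rewrite -(ltr_int R) (lt_le_trans _ rq)// lt_neqAle fr andbT -intrEfloor.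
    exact: rint.
  by rewrite !ler_int; split; lia.
- move=> y yZ yc; apply: GA; split=> // i.
  by have /andP[py yq] := yc i; rewrite (le_trans ap py) (le_trans yq qb).
Qed.

End CoordinateHulls.

(** * Cuts, faces and complexities for the box *)

Section Box.
Variables (R : realType) (n : nat) (C : certificate_system R n).
Variable D : set (split_disjunction n).
Hypotheses (n_gt0 : (0 < n)%N) (varD : @variable_disjunctions n `<=` D).

Let P := @box R n.

(** Positivity empties the children [x 0 i <= 0]; the bound [1 / 2] is what [few_normals_integral]
    requires. *)
Lemma box_lo_itv : 0 < box_lo R n <= 1 / 2.
Proof.
have n0 : 1 <= n%:R :> R by rewrite (ler_nat R 1).
rewrite /box_lo divr_gt0 ?mulr_gt0 ?ltr0n//=.
by rewrite ler_pM2l// lef_pV2 ?posrE ?mulr_gt0 ?ltr0n//; lra.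
Qed.

Lemma box_lo_round : 1%:~R - 1 < box_lo R n <= 1%:~R.
Proof. by rewrite mulr1z; have := box_lo_itv; lra. Qed.

(** [box_hi] is [n + 2] minus a positive amount of at most [1 / 2], so its floor is [n + 1]. *)
Lemma box_hi_round : (n%:Z + 1)%:~R <= box_hi R n < (n%:Z + 1)%:~R + 1.
Proof.
rewrite rmorphD /=; have := box_lo_itv; rewrite /box_hi -/(box_lo R n).
by rewrite -pmulrn; lra.
Qed.

Lemma integer_hull_box : integer_hull P = cube 1 (n%:R + 1).
Proof.
rewrite /P /box (hull_integer_cube _ _ _ _ _ _ box_lo_round box_hi_round).
by rewrite rmorphD.
Qed.

Lemma box_integer_points : P `&` @integer_points R n `<=` cube 1 (n%:R + 1).
Proof. by rewrite -integer_hull_box; apply: sub_gen_smallest. Qed.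

Lemma lower_bound_CG i :
  CG_cut P [set x : 'rV[R]_n | box_lo R n <= x 0 i] [set x : 'rV[R]_n | 1 <= x 0 i].
Proof.
split; last by rewrite (hull_ge_coord _ _ _ _ _ box_lo_round).
  (* The formula for [box_lo] is repeated over [rat], with the sign reversed to turn a lower bound
     into an upper one. *)
  exists (- delta_mx 0 i), (- (1 / (2 * n%:R))); split.
    by rewrite oppr_eq0 delta_row_neq0.
  by rewrite ge_coord_closed map_mxN map_delta_mx /box_lo rmorphN fmorph_div
    rmorphM !rmorph_nat rmorph1.
by move=> x /(_ i)/andP[].
Qed.

Lemma upper_bound_CG i :
  CG_cut P [set x : 'rV[R]_n | x 0 i <= box_hi R n]
    [set x : 'rV[R]_n | x 0 i <= n%:R + 1].
Proof.
split; last by rewrite (hull_le_coord _ _ _ _ _ box_hi_round) rmorphD.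
  exists (delta_mx 0 i), (2 + n%:R - 1 / (2 * n%:R)); split.
    exact: delta_row_neq0.
  by rewrite le_coord_closed map_delta_mx /box_hi rmorphB rmorphD fmorph_div
    rmorphM !rmorph_nat rmorph1.
by move=> x /(_ i)/andP[].
Qed.

Lemma lower_bound_face i :
  defines_face (integer_hull P) [set x : 'rV[R]_n | 1 <= x 0 i]
    (cube 1 (n%:R + 1) `&` [set x : 'rV[R]_n | x 0 i = 1]).
Proof.
exists (- delta_mx 0 i), (- 1); split.
- by rewrite oppr_eq0 delta_row_neq0.
- exact: ge_coord_closed.
- by rewrite integer_hull_box => x /(_ i)/andP[].
- rewrite integer_hull_box; congr (_ `&` _); apply/seteqP.
  by split=> x /=; rewrite -scaleN1r dotZl dot_delta; lra.
Qed.

Lemma upper_bound_face i :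
  defines_face (integer_hull P) [set x : 'rV[R]_n | x 0 i <= n%:R + 1]
    (cube 1 (n%:R + 1) `&` [set x : 'rV[R]_n | x 0 i = n%:R + 1]).
Proof.
exists (delta_mx 0 i), (n%:R + 1); split.
- exact: delta_row_neq0.
- exact: le_coord_closed.
- by rewrite integer_hull_box => x /(_ i)/andP[].
- rewrite integer_hull_box; congr (_ `&` _); apply/seteqP.
  by split=> x /=; rewrite dot_delta.
Qed.

Lemma lower_bound_complexity i :
  exists2 m, validity_complexity C D P [set x : 'rV[R]_n | 1 <= x 0 i] m & (m <= 3)%N.
Proof.
apply: (validity_complexity_le _ _ _ _ _ _ (positivity_tree R n C [:: i])).
- by rewrite ge_coord_closed; apply: halfspace_closed.
- by move=> x /box_integer_points/(_ i)/andP[].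
- exact: positivity_tree_based.
- apply: positivity_tree_leaves => [x j /(_ j)/andP[]|x _ /(_ i (mem_head _ _))//].
  by move=> + _; apply: lt_le_trans; case/andP: box_lo_itv.
Qed.

Lemma upper_bound_complexity i :
  exists2 m,
    validity_complexity C D P [set x : 'rV[R]_n | x 0 i <= n%:R + 1] m & (m <= 3)%N.
Proof.
have n1 : (n%:Z + 1)%:~R = n%:R + 1 :> R by rewrite rmorphD.
(* Branching at level [n + 1] suffices: the other child needs [n + 2 <= x 0 i], which exceeds
   [box_hi]. *)
pose t : bc_tree C :=
  Branch (variable_disjunction n i (n%:Z + 1)) (Leaf C) (Leaf C).
apply: (validity_complexity_le _ _ _ _ _ _ t).
- by rewrite le_coord_closed; apply: halfspace_closed.
- by move=> x /box_integer_points/(_ i)/andP[].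
- by split=> //; apply: varD; exists i.
- rewrite /= split_lo_variable split_hi_variable n1.
  split=> x [/(_ i)/andP[_ xhi]] //= hix.
  by have /andP[_] := box_hi_round; rewrite n1; lra.
Qed.

Lemma sum_validity_complexity :
  validity_complexity C D P
    [set x : 'rV[R]_n | n%:R <= \sum_(i < n) x 0 i] (2 * n + 1)%N.
Proof.
have H_sum1 x : (forall i, 1 <= x 0 i) -> n%:R <= \sum_(i < n) x 0 i :> R.
  move=> x1; rewrite -[X in X%:R](card_ord n) -sumr_const.
  by apply: ler_sum => i _.
split.
- have -> : [set x : 'rV[R]_n | n%:R <= \sum_(i < n) x 0 i] =
            closed_halfspace (const_mx (- 1)) (- n%:R).
    have dotN1 x : dot (const_mx (- 1)) x = - \sum_(i < n) x 0 i :> R.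
      by rewrite -sumrN; apply: eq_bigr => i _; rewrite mxE mulN1r.
    by apply/seteqP; split=> x; rewrite /closed_halfspace /= dotN1 lerN2.
  exact: halfspace_closed.
- by move=> x /box_integer_points xc; apply: H_sum1 => i; case/andP: (xc i).
- split.
    (* Branching once on every coordinate leaves one nonempty leaf, where all coordinates are at
       least 1. *)
    exists (positivity_tree R n C (enum 'I_n)).
      split; first exact: positivity_tree_based.
      apply: positivity_tree_leaves => [x j /(_ j)/andP[]|x _ x1].
        by move=> + _; apply: lt_le_trans; case/andP: box_lo_itv.
      by apply: H_sum1 => i; apply: x1; rewrite mem_enum.
    by rewrite positivity_tree_size -cardE card_ord.
  move=> _ [t [tP tH] <-].
  have [s le_s s_int] := tree_normals _ _ _ _ _ _ _ tP tH.
  rewrite leqNgt; apply/negP => lt_t.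
  have [|x [xc xn] xs] := few_normals_integral R n _ s box_lo_itv; first lia.
  (* The cube [[e, 1 + e]] with [e = box_lo] lies in the box, because [1 + e <= 2 + n - e]. *)
  have /s_int/(_ xs) : P x.
    move=> i; have /andP[-> /le_trans->//] := xc i.
    have := box_lo_itv; have : 1 <= n%:R :> R by rewrite (ler_nat R 1).
    by rewrite /box_hi -/(box_lo R n); lra.
  by rewrite /= leNgt xn.
Qed.

End Box.

(** * Facets of the hull matched with cuts, and the complexity bounds *)

Theorem theorem4p20 (R : realType) :
  exists c : nat,
    forall (n : nat) (C : certificate_system R n) (D : set (split_disjunction n)),
      (0 < n)%N -> @variable_disjunctions n `<=` D ->
      [/\ integer_hull (@box R n) = cube 1 (n%:R + 1),
          forall F : set 'rV[R]_n, facet (integer_hull (@box R n)) F ->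
            (exists G H : set 'rV[R]_n,
               [/\ bound_halfspace G, CG_cut (@box R n) G H,
                   defines_face (integer_hull (@box R n)) H F &
                   exists2 m : nat,
                     validity_complexity C D (@box R n) H m & (m <= c)%N]) /\
            (exists2 m : nat,
               facet_validity_complexity C D (@box R n) F m & (m <= c)%N) &
          validity_complexity C D (@box R n)
            [set x : 'rV[R]_n | n%:R <= \sum_(i < n) x 0 i]
            (2 * n + 1)%N].
Proof.
(* The constant is the size of a tree with a single branching node. *)
exists 3%N => n C D n_gt0 varD; split.
- exact: integer_hull_box.
- move=> F facetF.
  (* The cut found is among the halfspaces defining [F], so its complexity also bounds that of the
     facet. *)
  suff [G [H [bG cG dH [m vH m3]]]] : exists G H : set 'rV[R]_n,
      [/\ bound_halfspace G, CG_cut (@box R n) G H,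
          defines_face (integer_hull (@box R n)) H F &
          exists2 m : nat, validity_complexity C D (@box R n) H m & (m <= 3)%N].
    split; first by exists G, H; split=> //; exists m.
    have [k vF km] := defines_face_valid _ _ _ _ _ _ _ _ dH vH.
    by exists k => //; apply: leq_trans m3.
  move: facetF; rewrite {1}integer_hull_box// => facetF.
  have n1 : 1 < n%:R + 1 :> R by rewrite ltrDr ltr0n.
  have [i [[] ->]] := facet_cube _ _ _ _ _ n1 facetF.
    exists [set x : 'rV[R]_n | x 0 i <= box_hi R n],
      [set x : 'rV[R]_n | x 0 i <= n%:R + 1].
    split; [by exists i; right|exact: upper_bound_CG|exact: upper_bound_face|].
    exact: upper_bound_complexity.
  exists [set x : 'rV[R]_n | box_lo R n <= x 0 i], [set x : 'rV[R]_n | 1 <= x 0 i].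
  split; [by exists i; left|exact: lower_bound_CG|exact: lower_bound_face|].
  exact: lower_bound_complexity.
- exact: sum_validity_complexity.
Qed.
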